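(* Let $\mu$ be a joint distribution of $(X,A,Y)$ with $X\in\mathcal{X}\subseteq\mathbb{R}^d$, $A\in\{0,1\}$, $Y\in\{0,1\}$. Let $g:\mathcal{X}\to\mathcal{Z}$ be a (measurable) feature transformation, $h:\mathcal{Z}\to\{0,1\}$ a (measurable) classifier, and $\widehat{Y}=h(g(X))$. If $\widehat{Y}$ satisfies demographic parity (i.e. $\widehat{Y}$ is independent of $A$), then the joint error satisfies $$\mathrm{Err}_{\mu}(\widehat{Y})\;\ge\;H_{0\text{-}1}(A)\cdot\Delta_{\mathrm{BR}}(\mu_0,\mu_1).$$
   Context: For $a\in\{0,1\}$, $\mu_a$ denotes the conditional distribution of $\mu$ given $A=a$ (it is assumed $\Pr(A=a)>0$). The joint error is $\mathrm{Err}_\mu(\widehat{Y})=\Pr_\mu(Y\neq\widehat{Y})$. The difference of base rates is $\Delta_{\mathrm{BR}}(\mu_0,\mu_1)=|\mu_0(Y=1)-\mu_1(Y=1)|$. The zero-one entropy of $A$ is $H_{0\text{-}1}(A)=1-\max_{a\in\{0,1\}}\Pr(A=a)$. *)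

(* Defs.v *)
(* MathComp-Analysis *)
From HB Require Import structures.
From mathcomp Require Import all_boot all_order all_algebra.
From mathcomp Require Import all_classical all_reals all_analysis.

Set Implicit Arguments.
Unset Strict Implicit.
Unset Printing Implicit Defensive.
Import Order.TTheory GRing.Theory Num.Theory.
Import numFieldNormedType.Exports.

Local Open Scope classical_set_scope.
Local Open Scope ring_scope.

(* A subset D of a measurable space, as a measurable space with the trace
   sigma-algebra. D itself need not be measurable; the witness x0 is only there
   because measurable types are pointed. *)
Definition subspace_of d (T : measurableType d) (D : set T) (x0 : set_type D)
  : Type := set_type D.

Section subspace_of.
Context d (T : measurableType d) (D : set T) (x0 : set_type D).

HB.instance Definition _ := Choice.on (subspace_of x0).
HB.instance Definition _ := isPointed.Build (subspace_of x0) x0.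

Let inj : subspace_of x0 -> T := @set_val T D.

HB.instance Definition _ :=
  Measurable.copy (subspace_of x0) (g_sigma_algebra_preimageType inj).

End subspace_of.

Definition independent_rv d d1 d2 (T : measurableType d)
    (T1 : measurableType d1) (T2 : measurableType d2) (R : realType)
    (P : probability T R) (U : T -> T1) (V : T -> T2) : Prop :=
  forall B C, measurable B -> measurable C ->
    P (U @^-1` B `&` V @^-1` C) = (P (U @^-1` B) * P (V @^-1` C))%E.

(* Outcomes ((x, a), y) of the triple (X, A, Y); true stands for 1. *)
Section joint_distribution.
Context dX (X : measurableType dX) (R : realType).
Implicit Types (mu : probability (X * bool * bool)%type R) (a : bool).

Definition input (t : X * bool * bool) : X := t.1.1.
Definition attribute (t : X * bool * bool) : bool := t.1.2.
Definition label (t : X * bool * bool) : bool := t.2.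

Lemma measurable_attribute a : measurable (attribute @^-1` [set a]).
Proof.
rewrite -[_ @^-1` _]setTI.
by apply: (measurableT_comp measurable_snd measurable_fst).
Qed.

(* mu_a = mu (- `&` {A = a}) / mu {A = a}; the last argument of mnormalize is a
   default value, used only when mu {A = a} = 0. *)
Definition conditional mu a : probability (X * bool * bool)%type R :=
  mnormalize (mrestr mu (measurable_attribute a)) mu.

Definition joint_error mu (Yhat : X * bool * bool -> bool) : R :=
  fine (mu [set t | label t <> Yhat t]).

Definition base_rate_gap (mu0 mu1 : probability (X * bool * bool)%type R) : R :=
  `| fine (mu0 [set t | label t = true]) - fine (mu1 [set t | label t = true]) |.

Definition zero_one_entropy mu : R :=
  1 - Num.max (fine (mu [set t | attribute t = false]))
              (fine (mu [set t | attribute t = true])).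

Definition demographic_parity mu (Yhat : X * bool * bool -> bool) : Prop :=
  independent_rv mu Yhat attribute.

End joint_distribution.

(* Main.v *)
Require Import Defs.
From HB Require Import structures.
From mathcomp Require Import all_boot all_order all_algebra.
From mathcomp Require Import all_classical all_reals all_analysis.
From mathcomp Require Import ring lra.

Set Implicit Arguments.
Unset Strict Implicit.
Unset Printing Implicit Defensive.
Import Order.TTheory GRing.Theory Num.Theory.
Import numFieldNormedType.Exports.

Local Open Scope classical_set_scope.
Local Open Scope ring_scope.

(* Write p_a = Pr(A = a) and q = Pr(Yhat = 1). By parity Yhat has mean q given
   A = a, so the error within the group A = a is at least
   |Pr(Y = 1, A = a) - q p_a| = p_a |mu_a(Y = 1) - q|. Summing over a, bounding
   each p_a below by min(p_0, p_1) = H_{0-1}(A), and using the triangle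
   inequality through q gives the bound. *)

(** Subadditivity, used once in each direction. The set [D] absorbs the symmetric difference of [S]
    and [U]; in the application it is the error event within one group. *)
Lemma dist_fine_measure_le d (T : measurableType d) (R : realType)
    (P : probability T R) (S U D : set T) :
  measurable S -> measurable U -> measurable D ->
  S `<=` U `|` D -> U `<=` S `|` D ->
  `|fine (P S) - fine (P U)| <= fine (P D).
Proof.
move=> mS mU mD SUD USD.
have le_add V W : measurable V -> measurable W -> V `<=` W `|` D ->
    fine (P V) <= fine (P W) + fine (P D).
  move=> mV mW VWD; rewrite -fineD ?fin_num_measure// fine_le//.
  - exact: fin_num_measure.
  - by rewrite fin_numD !fin_num_measure.
  - apply: le_trans (measureU2 _ mW mD).
    by apply: le_measure => //; rewrite inE//; exact: measurableU.
by rewrite ler_distlC; have := le_add _ _ mS mU SUD;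
  have := le_add _ _ mU mS USD; lra.
Qed.

Lemma measurable_preimage_bool d (T : measurableType d) (f : T -> bool)
    (B : set bool) :
  measurable_fun setT f -> measurable (f @^-1` B).
Proof. by move=> mf; rewrite -[_ @^-1` _]setTI; exact: mf. Qed.

Lemma fine_conditional dX (X : measurableType dX) (R : realType)
    (mu : probability (X * bool * bool)%type R) (a : bool)
    (S : set (X * bool * bool)) :
  measurable S -> (0 < mu (@attribute _ X @^-1` [set a]))%E ->
  fine (conditional mu a S) =
    fine (mu (S `&` @attribute _ _ @^-1` [set a]))
      / fine (mu (@attribute _ _ @^-1` [set a])).
Proof.
move=> mS a_gt0; rewrite /conditional /=; unfold mnormalize; rewrite /= /mrestr setTI.
have a_fin := fin_num_measure mu _ (measurable_attribute a).
(* [mnormalize] falls back to its default when the total mass is zero or infinite; [a_gt0] and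
   [a_fin] exclude both cases. *)
rewrite (gt_eqF a_gt0) lt_eqF ?ltey_eq ?a_fin//= fineM// fin_num_measure//.
by apply: measurableI => //; exact: measurable_attribute.
Qed.

(** Two booleans differ exactly when one is the negation of the other, so the event is a finite
    union over the value [b] of [f]. *)
Lemma measurable_neq_bool d (T : measurableType d) (f g : T -> bool) :
  measurable_fun setT f -> measurable_fun setT g ->
  measurable [set t | f t <> g t].
Proof.
move=> mf mg.
rewrite (_ : [set t | _] = \bigcup_(b in setT)
    (f @^-1` [set b] `&` g @^-1` [set ~~ b])).
  by apply: fin_bigcup_measurable => // b _; apply: measurableI;
    exact: measurable_preimage_bool.
apply/seteqP; split => t /=; last by case=> b _ [/= -> ->]; case: b.
by move=> fg; exists (f t) => //; split => //=; move: fg; case: (f t) (g t) => -[].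
Qed.

Lemma fine_measure_split_bool d (T : measurableType d) (R : realType)
    (P : probability T R) (A : T -> bool) (S : set T) :
  measurable_fun setT A -> measurable S ->
  fine (P S) = fine (P (S `&` A @^-1` [set false]))
    + fine (P (S `&` A @^-1` [set true])).
Proof.
move=> mA mS.
have mSA b : measurable (S `&` A @^-1` [set b]).
  by apply: measurableI => //; exact: measurable_preimage_bool.
rewrite -fineD ?fin_num_measure// -measureU//.
- congr (fine (P _)); apply/seteqP; split => t /=; last by case=> -[].
  by move=> St; case E : (A t); [right|left].
- by apply/seteqP; split => t //= [[_ /= ->] [_]].
Qed.

(** The purely real part of the argument: [r0] and [r1] stand for Pr(Y = 1, A = a), so the quotients
    are the base rates. Any [q] works, provided it is the same for both groups. *)
Lemma min_mul_dist_le (R : realFieldType) (p0 p1 r0 r1 q : R) :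
  0 < p0 -> 0 < p1 ->
  Num.min p0 p1 * `|r0 / p0 - r1 / p1| <= `|r0 - q * p0| + `|r1 - q * p1|.
Proof.
move=> p0_gt0 p1_gt0.
have scale r p : 0 < p -> `|r - q * p| = p * `|r / p - q|.
  move=> p_gt0; rewrite -{2}(gtr0_norm p_gt0) -normrM; congr `|_|.
  by field; rewrite gt_eqF.
rewrite !scale//.
have min_ge0 : 0 <= Num.min p0 p1 by rewrite le_min !ltW.
apply: le_trans (ler_wpM2l min_ge0 (ler_distD q _ _)) _.
rewrite mulrDr [`|q - _|]distrC lerD// ler_wpM2r// ge_min lexx ?orbT//.
Qed.

(** Independence turns the product into Pr(Yhat = 1, A = a). Inside the group, {Y = 1} and {Yhat =
    1} can differ only where the prediction is wrong. *)
Lemma group_error_ge d (T : measurableType d) (R : realType)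
    (P : probability T R) (Y Yhat A : T -> bool) (a : bool) :
  measurable_fun setT Y -> measurable_fun setT Yhat -> measurable_fun setT A ->
  independent_rv P Yhat A ->
  `|fine (P (Y @^-1` [set true] `&` A @^-1` [set a]))
     - fine (P (Yhat @^-1` [set true])) * fine (P (A @^-1` [set a]))|
  <= fine (P ([set t | Y t <> Yhat t] `&` A @^-1` [set a])).
Proof.
move=> mY mYhat mA indep.
have mS (f : T -> bool) B : measurable_fun setT f -> measurable (f @^-1` B).
  exact: measurable_preimage_bool.
rewrite -fineM ?fin_num_measure//; try exact: mS.
rewrite -indep//.
apply: dist_fine_measure_le; do ?[apply: measurableI]; do ?exact: mS.
- exact: measurable_neq_bool.
- by move=> t [/= Yt At]; case: (Yhat t); [by left|right]; split => //=; rewrite Yt.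
- by move=> t [/= Yt At]; case: (Y t); [by left|right]; split => //=; rewrite Yt.
Qed.

Theorem corollary9 (R : realType) (d : nat)
    (calX : set (d.-tuple R)) (x0 : set_type calX)
    (dZ : measure_display) (calZ : measurableType dZ)
    (mu : probability (subspace_of x0 * bool * bool)%type R)
    (g : {mfun subspace_of x0 >-> calZ}) (h : {mfun calZ >-> bool})
    (Yhat := fun t : subspace_of x0 * bool * bool => h (g (input t)))
    (hA : forall a : bool, (0 < mu [set t | attribute t = a])%E)
    (hDP : demographic_parity mu Yhat) :
  joint_error mu Yhat >=
    zero_one_entropy mu
      * base_rate_gap (conditional mu false) (conditional mu true).
Proof.
have mA : measurable_fun setT (@attribute _ (subspace_of x0)).
  exact: measurableT_comp measurable_snd measurable_fst.
have mY : measurable_fun setT (@label _ (subspace_of x0)) by exact: measurable_snd.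
have mYhat : measurable_fun setT Yhat.
  apply: measurableT_comp => //; apply: measurableT_comp => //.
  exact: measurableT_comp measurable_fst measurable_fst.
have mE : measurable [set t | label t <> Yhat t].
  exact: measurable_neq_bool.
rewrite /joint_error (fine_measure_split_bool mu mA mE).
apply: le_trans (lerD (group_error_ge false mY mYhat mA hDP)
  (group_error_ge true mY mYhat mA hDP)).
have fA_gt0 a : 0 < fine (mu (@attribute _ _ @^-1` [set a])).
  by rewrite fine_gt0// hA/= ltey_eq fin_num_measure//; exact: measurable_attribute.
(* Unification sets [q] to Pr(Yhat = 1), the value shared by both group bounds. *)
apply: le_trans (min_mul_dist_le _ _ _ (fA_gt0 false) (fA_gt0 true)).
have := fine_measure_split_bool mu mA measurableT.
rewrite !setTI probability_setT /= => sum1.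
rewrite /base_rate_gap !fine_conditional; try exact: hA;
  try exact: (measurable_preimage_bool [set true]).
have -> : zero_one_entropy mu =
    Num.min (fine (mu (@attribute _ _ @^-1` [set false])))
            (fine (mu (@attribute _ _ @^-1` [set true]))).
  (* Since min + max is the sum of the two group probabilities, which is 1 by [sum1], 1 - max equals
     min. *)
  by apply/eqP; rewrite /zero_one_entropy subr_eq addr_min_max; apply/eqP.
by [].
Qed.
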